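(* Assume that the PDE $\partial_tu+\nabla\cdot(\mathbf q(u;\boldsymbol\theta_q))=r(u;\boldsymbol\theta_r)$, $\mathbf x\in\Omega$, $t>0$, is linear. Consider pairs of input CDFs (with finite first moments) $F^1_{u_0(\mathbf x)},F^2_{u_0(\mathbf x)}$, $\mathbf x\in\Omega$, and $F^1_{u_b(\mathbf x,t)},F^2_{u_b(\mathbf x,t)}$, $(\mathbf x,t)\in\Gamma\times\mathbb R_{\ge0}$, and let $F^1_{u(\mathbf x,t)}$, $F^2_{u(\mathbf x,t)}$ be the solutions of the CDF equation $$\frac{\partial F}{\partial t}+\dot{\mathbf q}(U;\boldsymbol\theta_q)\cdot\nabla F+r(U;\boldsymbol\theta_r)\frac{\partial F}{\partial U}=0,\qquad (U,\mathbf x)\in\mathbb R\times\Omega,\ t>0,$$ for the corresponding initial and boundary data. Let $w(\mathbf x,t)$ be the solution of $$\frac{\partial w}{\partial t}+\dot{\mathbf q}\cdot\nabla w-\dot r\,w=0,\quad\mathbf x\in\Omega,\ t>0,\qquad w(\mathbf x,0)=w_0(\mathbf x),\ \mathbf x\in\Omega,\qquad w(\mathbf x,t)=w_b(\mathbf x,t),\ \mathbf x\in\Gamma,\ t>0,$$ with initial and boundary conditions satisfying $$w_0(\mathbf x)\ge W_1\big(F^1_{u_0(\mathbf x)},F^2_{u_0(\mathbf x)}\big)\ \ \forall\mathbf x\in\Omega,\qquad w_b(\mathbf x,t)\ge W_1\big(F^1_{u_b(\mathbf x,t)},F^2_{u_b(\mathbf x,t)}\big)\ \ \forall(\mathbf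 x,t)\in\Gamma\times\mathbb R_{\ge0}.$$ Then $$W_1\big(F^1_{u(\mathbf x,t)},F^2_{u(\mathbf x,t)}\big)\le w(\mathbf x,t)\qquad\forall(\mathbf x,t)\in\Omega\times\mathbb R_{\ge0}.$$
   Context: $\Omega\subset\mathbb R^d$ is a semi-infinite spatial domain with upstream boundary $\Gamma$. The flux $\mathbf q$, source $r$ and their parameters $\boldsymbol\theta_q,\boldsymbol\theta_r$ (possibly depending on $(\mathbf x,t)$) are deterministic, and $\nabla\cdot\mathbf q(U;\boldsymbol\theta_q)=0$ for each fixed value $U$. $\dot{\mathbf q}=\partial\mathbf q/\partial U$, $\dot r=\partial r/\partial U$. ''Linear'' means $\mathbf q$ and $r$ are linear in $u$, so $\dot{\mathbf q}$ and $\dot r$ do not depend on $U$. $W_1$ is the 1-Wasserstein distance between scalar distributions, written in terms of their CDFs: $W_1(F,G)=\int_{\mathbb R}|F(s)-G(s)|ds$. The unknown $F_{u(\mathbf x,t)}(U)$ of the CDF equation is a function of $(U,\mathbf x,t)$, with data $F_{u_0(\mathbf x)}(U)$ on $\mathbb R\times\Omega$ at $t=0$ and $F_{u_b(\mathbf x,t)}(U)$ on $\mathbb R\times\Gamma$ for $t>0$. Solutions are understood by characteristics. For the CDF equation, the solution is constant along the curves $\frac{d\mathbf x}{dt}=\dot{\mathbf q}$, $\frac{dU}{dt}=r(U;\boldsymbol\theta_r)$ and equals the prescribed datum where the curve starts from the initial or boundary surface. For the equation of $w$, along the curves $\frac{d\mathbf x}{dt}=\dot{\mathbf q}$ one has $\frac{dw}{dt}=\dot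 r\,w$, with the prescribed value at the starting point. The coefficients are regular enough that each point of the space-time domain lies on exactly one such curve, started from exactly one point of the (noncharacteristic) initial/boundary surface; solutions are considered for all $t\ge0$. *)

(* Defs.v *)
From HB Require Import structures.
From mathcomp Require Import all_boot all_order all_algebra.
From mathcomp Require Import all_classical all_reals all_analysis.

Set Implicit Arguments.
Unset Strict Implicit.
Unset Printing Implicit Defensive.

Import Order.TTheory GRing.Theory Num.Theory.
Import numFieldNormedType.Exports.

Local Open Scope classical_set_scope.
Local Open Scope ring_scope.

Section Distributions.
Context {R : realType}.

(* Extended-real valued: an inequality [W1 F G <= c%:E] includes finiteness. *)
Definition W1 (F G : R -> R) : \bar R :=
  (\int[@lebesgue_measure R]_s (`|F s - G s|)%:E)%E.

(* A CDF is an element of [cumulativeBounded 0 1]: nondecreasing and right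
   continuous, with limits 0 at -oo and 1 at +oo.  Its law is the associated
   Lebesgue-Stieltjes measure. *)
Definition finite_first_moment (F : cumulativeBounded (0 : R) (1 : R)) : Prop :=
  (\int[lebesgue_stieltjes_measure F]_s (`|s|)%:E < +oo)%E.

End Distributions.

Section Domain.
Context {R : realType} {d : nat}.
Implicit Types (Omega Gamma : set 'rV[R]_d).

Definition semi_infinite_domain Omega Gamma : Prop :=
  [/\ open Omega, connected Omega, ~ bounded_set Omega,
      Gamma !=set0 & Gamma `<=` closure Omega `\` Omega].

Definition divergence (f : 'rV[R]_d -> 'rV[R]_d) (x : 'rV[R]_d) : R :=
  \sum_(i < d) 'D_(delta_mx 0 i) (fun y => f y 0 i) x.

Definition divergence_free_at (f : 'rV[R]_d -> 'rV[R]_d) (x : 'rV[R]_d) : Prop :=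
  (forall i, derivable (fun y => f y 0 i) x (delta_mx 0 i)) /\
  divergence f x = 0.

(* [Gamma] is included at [t = 0]: as it is disjoint from the open set [Omega],
   the curves issued from the corner would otherwise carry no datum. *)
Definition start_surface Omega Gamma (x : 'rV[R]_d) (t : R) : Prop :=
  (Omega x /\ t = 0) \/ (Gamma x /\ 0 <= t).

End Domain.

(* Linearity of a PDE in its unknown: a term not involving u is allowed. *)
Definition linear_in_u {R : realType} {V : normedModType R} (f : R -> V) : Prop :=
  exists a b : V, forall u, f u = u *: a + b.

Section Equations.
Context {R : realType} {d : nat} {Pq Pr : Type}.
Variables (Omega Gamma : set 'rV[R]_d).
Variables (q : R -> Pq -> 'rV[R]_d) (r : R -> Pr -> R).
Variables (thq : 'rV[R]_d -> R -> Pq) (thr : 'rV[R]_d -> R -> Pr).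

Definition qdot (U : R) (x : 'rV[R]_d) (t : R) : 'rV[R]_d :=
  derive1 (fun V => q V (thq x t)) U.

Definition rdot (U : R) (x : 'rV[R]_d) (t : R) : R :=
  derive1 (fun V => r V (thr x t) : R^o) U.

(* [xi] on [tau, T[ starts at time [tau] on the initial/boundary surface and then
   moves inside [Omega] with velocity [v]. [T] need not be maximal. The ODE is
   required after the starting time, where only continuity is asked. *)
Definition space_curve (v : R -> 'rV[R]_d) (tau T : R) (xi : R -> 'rV[R]_d) : Prop :=
  [/\ tau < T, start_surface Omega Gamma (xi tau) tau,
      xi s @[s --> tau^'+] --> xi tau &
      forall s, tau < s < T -> Omega (xi s) /\ is_derive s 1 xi (v s)].

(* Characteristics of the CDF equation; the state is the pair (U, x). *)
Definition cdf_characteristic (tau T : R) (z : R -> R * 'rV[R]_d) : Prop :=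
  let U := fun s => (z s).1 in
  let xi := fun s => (z s).2 in
  [/\ space_curve (fun s => qdot (U s) (xi s) s) tau T xi,
      U s @[s --> tau^'+] --> U tau &
      forall s, tau < s < T -> is_derive s 1 U (r (U s) (thr (xi s) s))].

(* Characteristics of the equation of w. There [q] is linear in u, so [qdot] does
   not depend on its first argument; it is evaluated at 0. *)
Definition w_characteristic (tau T : R) (xi : R -> 'rV[R]_d) : Prop :=
  space_curve (fun s => qdot 0 (xi s) s) tau T xi.

(* As the curves in [C] are not required to be maximal, uniqueness says that two
   of them with a common point start from the same point of the surface and
   coincide as long as both are defined. *)
Definition one_curve_through {E : Type} (C : R -> R -> (R -> E) -> Prop)
    (D : E -> R -> Prop) : Prop :=
  (forall p t, D p t ->
     exists tau T z, [/\ C tau T z, tau <= t < T & z t = p]) /\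
  (forall tau1 T1 z1 tau2 T2 z2 t, C tau1 T1 z1 -> C tau2 T2 z2 ->
     tau1 <= t < T1 -> tau2 <= t < T2 -> z1 t = z2 t ->
     tau1 = tau2 /\
     forall s, tau1 <= s -> s < T1 -> s < T2 -> z1 s = z2 s).

Definition unique_characteristics : Prop :=
  one_curve_through cdf_characteristic (fun z t => Omega z.2 /\ 0 <= t) /\
  one_curve_through w_characteristic (fun x t => Omega x /\ 0 <= t).

Definition cdf_solution (F0 : 'rV[R]_d -> R -> R) (Fb : 'rV[R]_d -> R -> R -> R)
    (F : 'rV[R]_d -> R -> R -> R) : Prop :=
  [/\ forall x U, Omega x -> F x 0 U = F0 x U,
      forall x t U, Gamma x -> 0 <= t -> F x t U = Fb x t U &
      forall tau T z, cdf_characteristic tau T z ->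
        forall s, tau <= s < T ->
          F (z s).2 s (z s).1 = F (z tau).2 tau (z tau).1].

(* [rdot] is evaluated at 0 for the same reason as [qdot] above. *)
Definition w_solution (w0 : 'rV[R]_d -> R) (wb w : 'rV[R]_d -> R -> R) : Prop :=
  [/\ forall x, Omega x -> w x 0 = w0 x,
      forall x t, Gamma x -> 0 <= t -> w x t = wb x t &
      forall tau T xi, w_characteristic tau T xi ->
        w (xi s) s @[s --> tau^'+] --> w (xi tau) tau /\
        forall s, tau < s < T ->
          is_derive s 1 (fun s' => w (xi s') s') (rdot 0 (xi s) s * w (xi s) s)].

End Equations.

(* Main.v *)
Require Import Defs.
From HB Require Import structures.
From mathcomp Require Import all_boot all_order all_algebra.
From mathcomp Require Import all_classical all_reals all_analysis.
From mathcomp Require Import measurable_realfun ring lra.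

Import Order.TTheory GRing.Theory Num.Theory.
Import numFieldNormedType.Exports.

Local Open Scope classical_set_scope.
Local Open Scope ring_scope.

(** Fix a point [(x, t)].  Because the flux is linear, the velocity [qdot] does
    not see the value of u, so the characteristics of the CDF equation through
    [(V, x)] at time [t], for all the values [V], project onto one and the same
    space curve, which is the characteristic of the equation of w
    ([cdf_characteristic_space]).  It starts from a point [x0] of the
    initial/boundary surface at a time [tau].

    Because the source is linear, the difference of the U-components of two of
    these characteristics satisfies the homogeneous equation y' = rdot y along
    that curve ([cdf_characteristic_sub]), which is also the equation of w.  Two
    solutions of a scalar homogeneous linear equation are proportional
    ([linear_ode_sol_ratio]).  Taking as reference the difference [y] of the
    characteristics with final values 1 and 0, so that [y t = 1], and setting
    [c = y tau], one finds ([affine_backward_characteristics])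

      F(x, t, V) = F(x0, tau, u0 + c V)   and   w(x0, tau) = c w(x, t).

    Uniqueness of the characteristics keeps [y] from vanishing, hence [0 < c].
    The affine change of variable in the integral that defines [W1] then gives
    c W1(F1(x, t), F2(x, t)) = W1(F1(x0, tau), F2(x0, tau)) ([W1_affine]), and
    the right-hand side is at most w(x0, tau) = c w(x, t) by the assumption on
    the data.  The coefficient [rdot] may be irregular in time: the ratio of two
    solutions is differentiated instead of writing exp of an integral. *)

(** * Affine functions of u *)

Section LinearInU.
Context {R : realType} {V : normedModType R}.

Lemma linear_in_u_derive1 (f : R -> V) : linear_in_u f ->
  forall u, derive1 f u = f 1 - f 0.
Proof.
move=> -[a [b fE]] u.
have -> : f 1 - f 0 = a by rewrite !fE scale1r scale0r add0r addrK.
have -> : f = (fun v => v *: a) + cst b by apply/funext => v; rewrite fE.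
have da : is_diff u ( *:%R ^~ a : R -> V) ( *:%R ^~ a) by exact: is_diff_scalel.
rewrite derive1E deriveD; last 2 first.
- by apply: diff_derivable; exact: ex_diff.
- exact: derivable_cst.
by rewrite derive_cst addr0 deriveE ?diff_val ?scale1r//; exact: ex_diff.
Qed.

Lemma linear_in_u_sub (f : R -> V) : linear_in_u f ->
  forall u v, f u - f v = (u - v) *: derive1 f 0.
Proof.
move=> lf u v; rewrite linear_in_u_derive1//; case: lf => a [b fE].
rewrite !fE scale1r scale0r add0r addrK scalerBl.
by rewrite opprD addrACA subrr addr0.
Qed.

End LinearInU.

(** * Affine change of variable in the Wasserstein distance *)

Section AffineChange.
Context {R : realType}.

(** The image of the Lebesgue measure under [s |-> u + c * s], multiplied by
    [c], gives every interval its length, so it is the Lebesgue measure.  The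
    substitution is done on measures because CDFs may jump. *)
Lemma ge0_integral_affine (f : R -> \bar R) (u c : R) : 0 < c ->
  measurable_fun [set: R] f -> (forall s, 0 <= f s)%E ->
  (c%:E * \int[@lebesgue_measure R]_s f (u + c * s)%R
   = \int[@lebesgue_measure R]_s f s)%E.
Proof.
move=> c0 mf f0.
pose phi : measurableTypeR R -> measurableTypeR R := fun s => u + c * s.
have mphi : measurable_fun setT phi.
  by apply: measurable_funD => //; apply: measurable_funM.
pose nu : {measure set measurableTypeR R -> \bar R} :=
  measure_function_pushforward__canonical__measure_function_Measure
    (@lebesgue_measure R) mphi.
have -> : (\int[@lebesgue_measure R]_s f (u + c * s)%R = \int[nu]_s f s)%E.
  by rewrite (ge0_integral_pushforward mphi)// => y _; exact: f0.
pose k : {nonneg R} := NngNum (ltW c0).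
rewrite -[LHS](ge0_integral_mscale nu measurableT k mf (fun y _ => f0 y)).
apply: eq_measure_integral => A mA _.
apply/esym; apply: lebesgue_measure_unique => //= _ [[a b]] _ <-.
rewrite /mscale /= /nu /= /pushforward.
have -> : phi @^-1` `]a, b] = `](a - u) / c, (b - u) / c]%classic.
  apply/seteqP; split => s /=;
    rewrite /phi !in_itv /= ltr_pdivrMr// ler_pdivlMr//;
    by move=> /andP[? ?]; apply/andP; split; lra.
rewrite !lebesgue_measure_itv /= !lte_fin ltr_pM2r ?invr_gt0// ltrD2r.
case: ifP => _; last by rewrite mule0.
rewrite -!EFinB -EFinM; congr (_%:E).
by field; rewrite gt_eqF.
Qed.

Lemma W1_affine (F G : R -> R) (u c : R) : 0 < c ->
  measurable_fun [set: R] F -> measurable_fun [set: R] G ->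
  (c%:E * W1 (fun s => F (u + c * s)%R) (fun s => G (u + c * s)%R)
   = W1 F G)%E.
Proof.
move=> c0 mF mG.
rewrite /W1 -(@ge0_integral_affine (fun s => (`|F s - G s|)%:E) u c)//.
apply/measurable_EFinP; apply: measurableT_comp => //.
exact: measurable_funB.
Qed.

Lemma measurable_cumulative (F : cumulativeBounded (0 : R) (1 : R)) :
  measurable_fun [set: R] F.
Proof.
by apply: nondecreasing_measurable => // x y; exact: cumulative_is_nondecreasing.
Qed.

End AffineChange.

(** * Scalar homogeneous linear differential equations *)

Section LinearOde.
Context {R : realType}.

(** At the starting time only right continuity is required, as it is for the
    characteristics. *)
Definition linear_ode_sol (a : R -> R) (tau t : R) (f : R -> R) : Prop :=
  f s @[s --> tau^'+] --> f tau /\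
  forall s, tau < s <= t -> is_derive s 1 f (a s * f s).

Lemma continuous_itv_of_derive (f df : R -> R) (tau t : R) : tau < t ->
  f s @[s --> tau^'+] --> f tau ->
  (forall s, tau < s <= t -> is_derive s 1 f (df s)) ->
  {within `[tau, t], continuous f}.
Proof.
move=> taut cf df_; have {}df_ s : tau < s <= t -> {for s, continuous f}.
  move=> /df_ ?; apply: differentiable_continuous.
  by apply/derivable1_diffP; exact: ex_derive.
apply/continuous_within_itvP => //; split => //.
- move=> s; rewrite in_itv /= => /andP[taus /ltW st].
  by apply: df_; rewrite taus.
- by apply: cvg_at_left_filter; apply: df_; rewrite taut lexx.
Qed.

(** The quotient of two solutions has zero derivative. *)
Lemma linear_ode_sol_ratio a tau t f g : tau <= t ->
  linear_ode_sol a tau t f -> linear_ode_sol a tau t g ->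
  (forall s, tau <= s <= t -> g s != 0) ->
  f tau / g tau = f t / g t.
Proof.
rewrite le_eqVlt => /predU1P[->//|taut] [cf df] [cg dg] g0.
pose h s := f s * (g s)^-1.
have dh s : tau < s <= t -> is_derive s (1 : R) h (cst 0 s).
  move=> st; have gs0 : g s != 0 by apply: g0; case/andP: st => /ltW -> ->.
  apply: (is_derive_eq (is_deriveM (df _ st) (is_deriveV gs0 (dg _ st)))).
  by rewrite /GRing.scale /=; field.
have ch : {within `[tau, t], continuous h}.
  apply: (continuous_itv_of_derive _ _ _ _ taut _ dh); apply: cvgM => //.
  by apply: cvgV => //; apply: g0; rewrite lexx ltW.
have [|c _] := @MVT _ h (cst 0) tau t taut _ ch.
  by move=> s; rewrite in_itv /= => /andP[taus /ltW st]; apply: dh; rewrite taus.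
by rewrite mul0r => /eqP; rewrite subr_eq0 => /eqP.
Qed.

Lemma linear_ode_sol_gt0 a tau t g : tau <= t -> linear_ode_sol a tau t g ->
  (forall s, tau <= s <= t -> g s != 0) -> 0 < g t -> 0 < g tau.
Proof.
rewrite le_eqVlt => /predU1P[->//|taut] [cg dg] g0 gt0.
rewrite ltNge; apply/negP => gtau.
have [|c + gc] := IVT (v := 0) (ltW taut)
    (continuous_itv_of_derive _ _ _ _ taut cg dg).
  by rewrite ge_min gtau le_max (ltW gt0) orbT.
by rewrite in_itv /= => /g0; rewrite gc eqxx.
Qed.

End LinearOde.

(** * Characteristics of a linear equation *)

Section Characteristics.
Context {R : realType} {d : nat} {Pq Pr : Type}.
Variables (Omega Gamma : set 'rV[R]_d).
Variables (q : R -> Pq -> 'rV[R]_d) (r : R -> Pr -> R).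
Variables (thq : 'rV[R]_d -> R -> Pq) (thr : 'rV[R]_d -> R -> Pr).
Hypothesis lq : forall th, linear_in_u (fun u => q u th).
Hypothesis lr : forall th, linear_in_u (fun u => r u th : R^o).
Hypothesis uc : unique_characteristics Omega Gamma q r thq thr.

Local Notation cdf_char := (cdf_characteristic Omega Gamma q r thq thr).
Local Notation w_char := (w_characteristic Omega Gamma q thq).

(** For a linear flux [qdot] takes the same value at [U] and at 0. *)
Lemma cdf_characteristic_space tau T z :
  cdf_char tau T z -> w_char tau T (fun s => (z s).2).
Proof.
case=> -[tT st cx dx] _ _; split => // s /dx[Ox dxs]; split => //.
by move: dxs; rewrite /qdot !(linear_in_u_derive1 _ (lq _)).
Qed.

(** The part of the source which does not involve u cancels in the
    difference. *)
Lemma cdf_characteristic_sub tau T1 T2 t z1 z2 :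
  cdf_char tau T1 z1 -> cdf_char tau T2 z2 -> t < T1 -> t < T2 ->
  (forall s, tau <= s <= t -> (z1 s).2 = (z2 s).2) ->
  linear_ode_sol (fun s => rdot r thr 0 (z2 s).2 s) tau t
    (fun s => (z1 s).1 - (z2 s).1).
Proof.
move=> [_ c1 d1] [_ c2 d2] tT1 tT2 e; split; first exact: cvgB.
move=> s /andP[taus st].
have h1 : is_derive s 1 (fun s => (z1 s).1) (r (z1 s).1 (thr (z1 s).2 s)).
  by apply: d1; rewrite taus (le_lt_trans st).
have h2 : is_derive s 1 (fun s => (z2 s).1) (r (z2 s).1 (thr (z2 s).2 s)).
  by apply: d2; rewrite taus (le_lt_trans st).
apply: (is_derive_eq (is_deriveB h1 h2)).
rewrite e ?(ltW taus)//.
by rewrite (linear_in_u_sub _ (lr _)) /rdot mulrC.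
Qed.

(** The backward flow of the characteristics from time [t] over a fixed [x] is
    an increasing affine map of the value [V].  Its slope [c] is the inverse of
    the growth factor of w along the same space curve.  None of [tau], [x0],
    [u0] and [c] depends on the data, so that two solutions can be compared. *)
Lemma affine_backward_characteristics x t : Omega x -> 0 <= t ->
  exists tau x0 u0 c, [/\ 0 < c, start_surface Omega Gamma x0 tau,
    (forall w0 wb w, w_solution Omega Gamma q r thq thr w0 wb w ->
       w x0 tau = c * w x t) &
    forall F0 Fb F, cdf_solution Omega Gamma q r thq thr F0 Fb F ->
      F x t = fun V => F x0 tau (u0 + c * V)].
Proof.
move=> Ox t0; have [[exc uqc] [_ uqw]] := uc.
have [tau [T [z [Cz /andP[taut tT] zt]]]] := exc (0, x) t (conj Ox t0).
have Cx := cdf_characteristic_space _ _ _ Cz.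
(* Uniqueness for the equation of w is what forces the common starting time and
   the common space curve of the characteristics through the other values. *)
have curve V : exists T' z', [/\ cdf_char tau T' z', t < T', z' t = (V, x) &
    forall s, tau <= s <= t -> (z' s).2 = (z s).2].
  have [tau' [T' [z' [Cz' /andP[taut' tT'] zt']]]] := exc (V, x) t (conj Ox t0).
  have [|||tauE xE] :=
    uqw _ _ _ _ _ _ t (cdf_characteristic_space _ _ _ Cz') Cx.
  - by rewrite taut'.
  - by rewrite taut.
  - by rewrite zt' zt.
  rewrite tauE in Cz' xE; exists T', z'; split => // s /andP[taus st].
  by apply: xE => //; exact: le_lt_trans st _.
have [T1 [z1 [Cz1 tT1 z1t e1]]] := curve 1.
pose y s := (z1 s).1 - (z s).1.
have sy := cdf_characteristic_sub _ _ _ _ _ _ Cz1 Cz tT1 tT e1.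
(* A zero of [y] is a common point of the two curves, which would then agree up
   to time [t], where their values are 1 and 0. *)
have y0 s : tau <= s <= t -> y s != 0.
  move=> /andP[taus st]; apply/eqP => /eqP; rewrite subr_eq0 => /eqP ys.
  have [|||_ zE] := uqc _ _ _ _ _ _ s Cz1 Cz.
  - by rewrite taus (le_lt_trans st).
  - by rewrite taus (le_lt_trans st).
  - by rewrite (surjective_pairing (z1 s)) (surjective_pairing (z s)) ys e1 ?taus.
  have := zE _ taut tT1 tT; rewrite z1t zt => -[/eqP].
  by rewrite oner_eq0.
have yt : y t = 1 by rewrite /y z1t zt subr0.
have ytau : 0 < y tau.
  by apply: (linear_ode_sol_gt0 _ _ _ _ taut sy y0); rewrite -/(y t) yt.
have tau_itv : tau <= tau <= t by rewrite lexx.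
exists tau, (z tau).2, (z tau).1, (y tau); split => //.
- by case: Cz => -[].
- move=> w0 wb w [_ _ /(_ _ _ _ Cx)[cw dw]].
  have sw : linear_ode_sol (fun s => rdot r thr 0 (z s).2 s) tau t
      (fun s => w (z s).2 s).
    by split => // s /andP[taus st]; apply: dw; rewrite taus (le_lt_trans st).
  have := linear_ode_sol_ratio _ _ _ _ _ taut sw sy y0.
  rewrite /= -/(y t) -/(y tau) yt zt divr1 /= => <-.
  by rewrite mulrC divfK// y0.
- move=> F0 Fb F [_ _ FC]; apply/funext => V.
  have [T' [z' [Cz' tT' zt' e']]] := curve V.
  have := FC _ _ _ Cz' t; rewrite zt' /= => -> //; last by rewrite taut.
  rewrite (e' tau)//; congr (F _ _ _).
  have := linear_ode_sol_ratio _ _ _ _ _ taut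
    (cdf_characteristic_sub _ _ _ _ _ _ Cz' Cz tT' tT e') sy y0.
  rewrite /= -/(y t) -/(y tau) yt zt' zt /= subr0 divr1 => <-.
  by rewrite mulrC divfK ?y0// addrC subrK.
Qed.

End Characteristics.

(** * The comparison *)

Theorem corollary5p5 (R : realType) (d : nat) (Pq Pr : Type)
  (Omega Gamma : set 'rV[R]_d)
  (q : R -> Pq -> 'rV[R]_d) (r : R -> Pr -> R)
  (thq : 'rV[R]_d -> R -> Pq) (thr : 'rV[R]_d -> R -> Pr)
  (F10 F20 : 'rV[R]_d -> cumulativeBounded (0 : R) (1 : R))
  (F1b F2b : 'rV[R]_d -> R -> cumulativeBounded (0 : R) (1 : R))
  (F1 F2 : 'rV[R]_d -> R -> R -> R)
  (w0 : 'rV[R]_d -> R) (wb w : 'rV[R]_d -> R -> R) :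
  semi_infinite_domain Omega Gamma ->
  (forall U x t, Omega x -> 0 < t ->
     divergence_free_at (fun y => q U (thq y t)) x) ->
  (forall th, linear_in_u (fun u => q u th)) ->
  (forall th, linear_in_u (fun u => r u th : R^o)) ->
  unique_characteristics Omega Gamma q r thq thr ->
  (forall x, Omega x ->
     finite_first_moment (F10 x) /\ finite_first_moment (F20 x)) ->
  (forall x t, Gamma x -> 0 <= t ->
     finite_first_moment (F1b x t) /\ finite_first_moment (F2b x t)) ->
  cdf_solution Omega Gamma q r thq thr
    (fun x => F10 x) (fun x t => F1b x t) F1 ->
  cdf_solution Omega Gamma q r thq thr
    (fun x => F20 x) (fun x t => F2b x t) F2 ->
  w_solution Omega Gamma q r thq thr w0 wb w ->
  (forall x, Omega x -> (W1 (F10 x) (F20 x) <= (w0 x)%:E)%E) ->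
  (forall x t, Gamma x -> 0 <= t ->
     (W1 (F1b x t) (F2b x t) <= (wb x t)%:E)%E) ->
  forall x t, Omega x -> 0 <= t -> (W1 (F1 x t) (F2 x t) <= (w x t)%:E)%E.
Proof.
move=> _ _ lq lr uc _ _ S1 S2 Sw le0 leb x t Ox t0.
have [tau [x0 [u0 [c [c0 st wE FE]]]]] :=
  affine_backward_characteristics _ _ _ _ _ _ lq lr uc _ _ Ox t0.
rewrite (FE _ _ _ S1) (FE _ _ _ S2) -(@lee_pmul2l _ c%:E)//.
rewrite -EFinM -(wE _ _ _ Sw).
case: S1 S2 Sw => F1i F1g _ [F2i F2g _] [wi wg _].
case: st => [[Ox0 tau0]|[Gx0 tau0]].
- rewrite tau0 wi//.
  have -> : F1 x0 0 = F10 x0 by apply/funext => U; exact: F1i.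
  have -> : F2 x0 0 = F20 x0 by apply/funext => U; exact: F2i.
  by rewrite W1_affine ?le0//; exact: measurable_cumulative.
- rewrite wg//.
  have -> : F1 x0 tau = F1b x0 tau by apply/funext => U; exact: F1g.
  have -> : F2 x0 tau = F2b x0 tau by apply/funext => U; exact: F2g.
  by rewrite W1_affine ?leb//; exact: measurable_cumulative.
Qed.
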